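(* There is an equivalence relation $\sim$ on $\mathbb{R}$ such that, letting $S:=\mathbb{R}/\sim$, there is no good $S$-predictor on $\mathbb{R}$ that is anonymous with respect to $D^\infty_{\mathrm{Lip}}$; in fact there is no good weak $S$-predictor that is anonymous with respect to $D^\infty_{\mathrm{Lip}}$.
   Context: $D^\infty_{\mathrm{Lip}}$ (the infinitely Lipschitz diffeomorphisms) is the set of increasing bijections $f:\mathbb{R}\to\mathbb{R}$ such that $f$ and $f^{-1}$ are $C^\infty$ and for every $k\ge 1$ the derivatives $f^{(k)}$ and $(f^{-1})^{(k)}$ are bounded on $\mathbb{R}$. An $S$-predictor is a function $\mathcal{P}$ from the set of $S$-valued functions with domain $(-\infty,t_f)$ for some $t_f\in\mathbb{R}$ into $S$; it is good if for every $F:\mathbb{R}\to S$ the set $\{t:\mathcal{P}(F|_{(-\infty,t)})\ne F(t)\}$ has Lebesgue measure zero; for $U\subseteq\mathrm{Homeo}^+(\mathbb{R})$ (increasing homeomorphisms) it is $U$-anonymous if $\mathcal{P}(f)=\mathcal{P}(f\circ\varphi)$ for all such $f$ and all $\varphi\in U$, where $f\circ\varphi$ has domain $(-\infty,\varphi^{-1}(t_f))$. A weak $S$-predictor is a function $\mathcal{Q}$ from the set of $S$-valued functions $f$ with domain $\mathbb{R}\setminus\{h_f\}$ for some $h_f\in\mathbb{R}$ into $S$. It is good if for every $F:\mathbb{R}\to S$ the set $\{x:\mathcal{Q}(F|_{\mathbb{R}\setminus\{x\}})\neq F(x)\}$ has Lebesgue measure zero. For $U\subseteq\mathrm{Homeo}^+(\mathbb{R})$,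 $\mathcal{Q}$ is $U$-anonymous if whenever $f,g$ are such functions with holes $h_f,h_g$, $\varphi\in U$, $\varphi(h_f)=h_g$ and $f=(g\circ\varphi)|_{\mathbb{R}\setminus\{h_f\}}$, then $\mathcal{Q}(f)=\mathcal{Q}(g)$. *)

(* Defs.v *)
From HB Require Import structures.
From mathcomp Require Import all_boot all_order all_algebra.
From mathcomp Require Import all_classical all_reals all_analysis.
Unset Printing Implicit Defensive.
Import Order.TTheory GRing.Theory Num.Theory numFieldNormedType.Exports.
Local Open Scope classical_set_scope.
Local Open Scope ring_scope.

Section Defs.
Variable R : realType.

Definition smooth (f : R -> R) : Prop :=
  forall (n : nat) (x : R), derivable (derive1n n f) x 1.

Definition bounded_derivs (f : R -> R) : Prop :=
  forall k : nat, (0 < k)%N -> exists M : R, forall x : R, `|derive1n k f x| <= M.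

Definition DinfLip (f : R -> R) : Prop :=
  (forall x y : R, x < y -> f x < f y) /\
  exists g : R -> R, cancel f g /\ cancel g f /\
    smooth f /\ smooth g /\ bounded_derivs f /\ bounded_derivs g.

Definition lnull (A : set R) : Prop :=
  (@lebesgue_measure R).-negligible A.

Definition quot (E : R -> R -> Prop) : Type :=
  {A : set R | exists x : R, A = E x}.

Definition is_equiv_rel (E : R -> R -> Prop) : Prop :=
  (forall x, E x x) /\ (forall x y, E x y -> E y x) /\
  (forall x y z, E x y -> E y z -> E x z).

Definition predictor (S : Type) : Type :=
  forall t : R, ({x : R | x < t} -> S) -> S.

Definition restr_lt (S : Type) (F : R -> S) (t : R) : {x : R | x < t} -> S :=
  fun x => F (sval x).

Definition good_predictor (S : Type) (P : predictor S) : Prop :=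
  forall F : R -> S, lnull [set t | P t (restr_lt S F t) <> F t].

(* U-anonymity: P f = P (f o phi), where f has domain (-oo, t_f) and f o phi
   has domain (-oo, phi^{-1} t_f).  Every f on (-oo,t_f) is the restriction
   of a total F, and writing t_f = phi s this reads as below. *)
Definition anonymous_predictor (S : Type) (U : (R -> R) -> Prop)
    (P : predictor S) : Prop :=
  forall (phi : R -> R), U phi -> forall (F : R -> S) (s : R),
    P (phi s) (restr_lt S F (phi s)) = P s (restr_lt S (F \o phi) s).

Definition weak_predictor (S : Type) : Type :=
  forall h : R, ({x : R | x <> h} -> S) -> S.

Definition restr_ne (S : Type) (F : R -> S) (h : R) : {x : R | x <> h} -> S :=
  fun x => F (sval x).

Definition good_weak_predictor (S : Type) (Q : weak_predictor S) : Prop :=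
  forall F : R -> S, lnull [set x | Q x (restr_ne S F x) <> F x].

(* U-anonymity for weak predictors: if phi in U, phi h_f = h_g and
   f = (g o phi) on R \ {h_f} then Q f = Q g.  Every g is the restriction of a
   total G, so this reads as below. *)
Definition anonymous_weak_predictor (S : Type) (U : (R -> R) -> Prop)
    (Q : weak_predictor S) : Prop :=
  forall (phi : R -> R), U phi -> forall (G : R -> S) (h : R),
    Q h (restr_ne S (G \o phi) h) = Q (phi h) (restr_ne S G (phi h)).

End Defs.
Arguments restr_lt {R S} F t.
Arguments quot {R} E.
Arguments is_equiv_rel {R} E.
Arguments DinfLip {R} f.
Arguments restr_ne {R S} F h.
Arguments good_predictor {R S} P.
Arguments anonymous_predictor {R S} U P.
Arguments good_weak_predictor {R S} Q.
Arguments anonymous_weak_predictor {R S} U Q.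

(* Main.v *)
(* Let z = cot(theta) be the projective coordinate on the universal cover R of
   the projective line; Moebius maps lift to infinitely Lipschitz
   diffeomorphisms of R. Let K be a proper subfield of the reals, relatively
   algebraically closed and not Lebesgue null, and let t be real and
   transcendental over K. For a in K, 0 < a < 1, let phi_a be the lift of
   z |-> a - 1 / (z + a t), so that phi_a(0) = pi / 2 - atan a. A degree
   argument on continued fractions in K(t) shows that no nonempty reduced word
   in the phi_a fixes 0 (that is, z = oo). Let ~ be generated by
   u ~ phi_a(u) for u <> 0 only. The graph being a tree around 0, the points
   phi_a(0) are pairwise inequivalent. If F is the quotient map, then
   F o phi_a = F off 0, so an anonymous weak predictor makes the same guess for
   F at all the points phi_a(0), and is right at one of them at most; but these
   points do not form a null set.

   To find K, take a transcendence basis T of the reals over the prime field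
   and distinct t_0, t_1, ... in T. The relative algebraic closures of
   T \ {t_n, t_(n+1), ...} are proper and increase to the whole line, so one of
   them is large enough by countable additivity. *)
From HB Require Import structures.
Require Import Defs.
From mathcomp Require Import all_boot all_order all_algebra.
From mathcomp Require Import all_classical all_reals all_analysis.
From mathcomp Require Import ring lra.
Set Implicit Arguments.
Unset Strict Implicit.
Unset Printing Implicit Defensive.
Import Order.TTheory GRing.Theory Num.Theory numFieldNormedType.Exports.
Local Open Scope classical_set_scope.
Local Open Scope ring_scope.

(** * Relative algebraic closure *)

Section Subfield.
Variables (F : fieldType) (S : divringClosed F).

Record subfield_of := SubfieldOf { subfield_val : F; _ : subfield_val \in S }.

HB.instance Definition _ := [isSub for subfield_val].
HB.instance Definition _ := [Choice of subfield_of by <:].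
HB.instance Definition _ := [SubChoice_isSubComUnitRing of subfield_of by <:].
HB.instance Definition _ :=
  [SubComUnitRing_isSubIntegralDomain of subfield_of by <:].
HB.instance Definition _ :=
  [SubIntegralDomain_isSubField of subfield_of by <:].

(** Over a field, algebraic and integral elements coincide, and integrality is transitive. *)
Lemma algebraicOver_root (p : {poly F}) x :
  (forall i, algebraicOver (val : subfield_of -> F) p`_i) ->
  p != 0 -> root p x -> algebraicOver (val : subfield_of -> F) x.
Proof.
move=> algp p0 px; apply/integral_algebraic; apply: integral_root p0 px _.
by apply/integral_poly => i; apply/integral_algebraic.
Qed.

End Subfield.

Section RelativeAlgebraicClosure.
Variable F : fieldType.
Implicit Types (A B C : set F) (x y z : F) (p : {poly F}).

Definition coefs_in C p := forall i, C p`_i.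

Definition alg_closed_in C := [/\ C 1,
  forall x y, C x -> C y -> C (x - y),
  forall x y, C x -> C y -> C (x / y) &
  forall p x, coefs_in C p -> p != 0 -> root p x -> C x].

Definition acl A : set F := fun x =>
  forall C, alg_closed_in C -> A `<=` C -> C x.

Lemma acl_min A C : alg_closed_in C -> A `<=` C -> acl A `<=` C.
Proof. by move=> cC AC x; apply. Qed.

Lemma sub_acl A : A `<=` acl A.
Proof. by move=> x Ax C _; apply. Qed.

Lemma acl_closed A : alg_closed_in (acl A).
Proof.
split.
- by move=> C [].
- move=> x y Cx Cy C cC AC; case: (cC) => _ + _ _.
  by apply; [apply: Cx|apply: Cy].
- move=> x y Cx Cy C cC AC; case: (cC) => _ _ + _.
  by apply; [apply: Cx|apply: Cy].
- move=> p x Cp p0 px C cC AC; case: (cC) => _ _ _.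
  by apply; [move=> i; apply: Cp|exact: p0|exact: px].
Qed.

Lemma aclS A B : A `<=` B -> acl A `<=` acl B.
Proof.
by move=> AB; apply: acl_min (acl_closed B) _ => x /AB; apply: sub_acl.
Qed.


(** The elements with a finite witness already form a closed set, since finitely many finite
    witnesses can be concatenated. *)
Lemma acl_finitary A x : acl A x ->
  exists2 s : seq F, [set` s] `<=` A & acl [set` s] x.
Proof.
move: x; apply: acl_min => [|x Ax]; last first.
  exists [:: x]; first by move=> y /=; rewrite inE => /eqP ->.
  by apply: sub_acl; rewrite /= inE.
have catA s1 s2 : [set` s1] `<=` A -> [set` s2] `<=` A -> [set` s1 ++ s2] `<=` A.
  by move=> s1A s2A y /=; rewrite mem_cat => /orP[/s1A|/s2A].
have catl s1 s2 : acl [set` s1] `<=` acl [set` s1 ++ s2].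
  by apply: aclS => y /= ys; rewrite mem_cat ys.
have catr s1 s2 : acl [set` s2] `<=` acl [set` s1 ++ s2].
  by apply: aclS => y /= ys; rewrite mem_cat ys orbT.
split.
- by exists [::] => //; case: (acl_closed [set` [::]]).
- move=> x y [s sA sx] [r rA ry]; exists (s ++ r); first exact: catA.
  case: (acl_closed [set` s ++ r]) => _ + _ _.
  by apply; [apply: catl|apply: catr].
- move=> x y [s sA sx] [r rA ry]; exists (s ++ r); first exact: catA.
  case: (acl_closed [set` s ++ r]) => _ _ + _.
  by apply; [apply: catl|apply: catr].
- move=> p x cp p0 px.
  have [s sA sp] : exists2 s : seq F, [set` s] `<=` A & coefs_in (acl [set` s]) p.
    have [s sA sp] : exists2 s : seq F, [set` s] `<=` A &
        forall i, (i < size p)%N -> acl [set` s] p`_i.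
      elim: (size p) => [|n [s sA sp]]; first by exists [::].
      have [r rA rp] := cp n; exists (s ++ r); first exact: catA.
      move=> i; rewrite ltnS leq_eqVlt => /predU1P[->|/sp]; first exact: catr.
      exact: catl.
    exists s => // i; have [/sp//|ip] := ltnP i (size p).
    rewrite nth_default//; case: (acl_closed [set` s]) => s1 sB _ _.
    by rewrite -(subrr 1); apply: sB.
  exists s => //; case: (acl_closed [set` s]) => _ _ _.
  by apply; [exact: sp|exact: p0|exact: px].
Qed.

Lemma roots_enum p : p != 0 -> exists s : seq F, forall x, root p x -> x \in s.
Proof.
have [n] := ubnP (size p); elim: n p => // n IHn p pn p0.
have [[x px]|nr] := pselect (exists x, root p x); last first.
  by exists [::] => x px; case: nr; exists x.
have [q pE] := factor_theorem p x px.
have q0 : q != 0 by apply: contraNneq p0 => q0; rewrite pE q0 mul0r.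
have [|s sq] := IHn q _ q0.
  move: pn; rewrite pE size_Mmonic ?monicXsubC// size_XsubC addn2 /=.
  by rewrite ltnS.
exists (x :: s) => y; rewrite pE rootM root_XsubC inE => /orP[/sq ->|->//].
by rewrite orbT.
Qed.

(* Every element of the algebraic closure of a countable set is the value of a
   finite tree whose leaves index that set and whose inner nodes denote field
   operations or the selection of a root of a polynomial. *)
Lemma countable_acl A : countable A -> countable (acl A).
Proof.
move=> /countable_injP[f finj].
(* Indices outside the image of [f] receive 0; only an inclusion is claimed, so an empty [A] is
   covered. *)
have [a Aa] : exists a : nat -> F, A `<=` range a.
  exists (fun n => xget 0 [set x | A x /\ f x = n]) => x Ax; exists (f x) => //.
  case: xgetP => [y _ [Ay fxy]|/(_ x)]; last by case.
  by apply: finj => //; rewrite inE.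
have /boolp.choice[r rP] : forall p, exists s : seq F,
    p != 0 -> forall x, root p x -> x \in s.
  move=> p; have [->|/roots_enum[s sp]] := eqVneq p 0; last by exists s.
  by exists [::].
pose op k (s : seq F) := match k with
  | 0 => 1
  | 1 => s`_0 - s`_1
  | 2 => s`_0 / s`_1
  | k.+3 => (r (Poly s))`_k
  end.
pose fix ev (t : GenTree.tree nat) : F := match t with
  | GenTree.Leaf n => a n
  | GenTree.Node k ts => op k (map ev ts)
  end.
apply: (@sub_countable _ _ _ [set: GenTree.tree nat]); last exact: countableP.
apply: (@card_le_trans _ _ _ (range ev)); last exact: card_image_le.
apply: subset_card_le; apply: acl_min; last first.
  by move=> x /Aa[n _ <-]; exists (GenTree.Leaf n).
split.
- by exists (GenTree.Node 0 [::]).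
- by move=> _ _ [t _ <-] [u _ <-]; exists (GenTree.Node 1 [:: t; u]).
- by move=> _ _ [t _ <-] [u _ <-]; exists (GenTree.Node 2 [:: t; u]).
- move=> p x cp p0 px.
  have /boolp.choice[g gP] : forall i, exists t, ev t = p`_i.
    by move=> i; have [t _ tE] := cp i; exists t.
  exists (GenTree.Node (index x (r p)).+3 [seq g i | i <- iota 0 (size p)]) => //=.
  rewrite -map_comp (@eq_map _ _ (ev \o g) (fun i => p`_i)) => [|i]; last exact: gP.
  by rewrite -/(mkseq _ _) mkseq_nth polyseqK nth_index// rP.
Qed.

Section ClosedOps.
Variables (C : set F) (cC : alg_closed_in C).

Definition alg_closed_mem : F -> bool := fun x => `[< C x >].

Lemma alg_closed_divring : divring_closed alg_closed_mem.
Proof.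
case: cC => C1 CB CD _; split; first by apply/asboolP.
- by move=> x y /asboolP Cx /asboolP Cy; apply/asboolP; apply: CB.
- by move=> x y /asboolP Cx /asboolP Cy; apply/asboolP; apply: CD.
Qed.

End ClosedOps.

Definition divring_of C (cC : alg_closed_in C) : divringClosed F :=
  HB.pack (alg_closed_mem C)
    (GRing.isDivringClosed.Build F (alg_closed_mem C) (alg_closed_divring cC)).

Lemma divring_ofE C (cC : alg_closed_in C) x : x \in divring_of cC <-> C x.
Proof. by split => [/asboolP|Cx]; last exact/asboolP. Qed.

Lemma polyOver_divring_of C (cC : alg_closed_in C) p :
  p \is a polyOver (divring_of cC) <-> coefs_in C p.
Proof.
split=> [/polyOverP pC i|pC]; first exact/divring_ofE/pC.
by apply/polyOverP => i; apply/divring_ofE.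
Qed.

(** * Simple extensions and the exchange property *)

Section Adjoin.
Variables (S : divringClosed F) (x : F).

Definition adjoin : F -> bool := fun z =>
  `[< exists u v : {poly F}, [/\ u \is a polyOver S, v \is a polyOver S,
       v.[x] != 0 & z = u.[x] / v.[x]] >].

Lemma adjoin_divring : divring_closed adjoin.
Proof.
split.
- apply/asboolP; exists 1, 1; rewrite !rpred1 hornerC oner_neq0 divr1.
  by split.
- move=> _ _ /asboolP[u [v [uS vS v0 ->]]] /asboolP[u' [v' [uS' vS' v0' ->]]].
  apply/asboolP; exists (u * v' - u' * v), (v * v').
  rewrite rpredB ?rpredM// !hornerE; split => //; first by rewrite mulf_neq0.
  by field; rewrite v0 v0'.
- move=> _ _ /asboolP[u [v [uS vS v0 ->]]] /asboolP[u' [v' [uS' vS' v0' ->]]].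
  apply/asboolP; have [u0|u0] := eqVneq u'.[x] 0.
    (* Division by zero yields 0, represented as 0 / 1. *)
    exists 0, 1; rewrite rpred0 rpred1 !hornerC oner_neq0 u0.
    by rewrite !(mul0r, invr0, mulr0).
  exists (u * v'), (v * u').
  rewrite !rpredM// !hornerE; split => //; first by rewrite mulf_neq0.
  by field; rewrite v0 v0' u0.
Qed.

Definition adjoin_pred : divringClosed F :=
  HB.pack adjoin (GRing.isDivringClosed.Build F adjoin adjoin_divring).

Lemma adjoin_base z : z \in S -> z \in adjoin_pred.
Proof.
move=> zS; apply/asboolP; exists z%:P, 1; rewrite polyOverC rpred1 !hornerC.
by rewrite oner_neq0 divr1.
Qed.

Lemma adjoin_gen : x \in adjoin_pred.
Proof.
by apply/asboolP; exists 'X, 1; rewrite polyOverX rpred1 !hornerE oner_neq0 divr1.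
Qed.

Lemma adjoin_common_denom (s : seq F) : {subset s <= adjoin_pred} ->
  exists v : {poly F}, [/\ v \is a polyOver S, v.[x] != 0 &
    forall z, z \in s ->
      exists2 u : {poly F}, u \is a polyOver S & u.[x] = z * v.[x]].
Proof.
elim: s => [|z s IHs] sS; first by exists 1; rewrite rpred1 hornerC oner_neq0.
have [|v [vS v0 vs]] := IHs; first by move=> y ys; apply: sS; rewrite inE ys orbT.
have /asboolP[u [w [uS wS w0 zE]]] : z \in adjoin_pred by rewrite sS// mem_head.
exists (w * v); rewrite rpredM// hornerM mulf_neq0//; split => // y.
rewrite inE => /predU1P[->|/vs[t tS tE]].
  by exists (u * v); rewrite ?rpredM// hornerM zE; field.
by exists (w * t); rewrite ?rpredM// hornerM tE; ring.
Qed.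

End Adjoin.

Lemma acl_adjoin K (cK : alg_closed_in K) x :
  acl (K `|` [set x]) `<=`
  algebraicOver (val : subfield_of (adjoin_pred (divring_of cK) x) -> F).
Proof.
apply: acl_min; last first.
  move=> y yK; have yS : y \in adjoin_pred (divring_of cK) x.
    case: yK => [Ky|->]; last exact: adjoin_gen.
    by apply: adjoin_base; apply/divring_ofE.
  exact: (algebraic_id val (SubfieldOf yS)).
split; first exact: (algebraic1 val).
- by move=> y z; apply: algebraic_sub.
- by move=> y z; apply: algebraic_div.
- by move=> p y cp p0 py; apply: (algebraicOver_root cp).
Qed.

(* A nonzero relation P(x, y) = 0 over K cannot have all its coefficients, read
   as polynomials in x, vanish at y, since y is transcendental over K. *)
Lemma acl_exchange K x y : alg_closed_in K ->
  acl (K `|` [set x]) y -> ~ K y -> acl (K `|` [set y]) x.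
Proof.
move=> cK /(acl_adjoin cK)[p p0 py] nKy.
pose q := map_poly val p.
have q0 : q != 0 by rewrite map_poly_eq0.
have [|v [vS v0 vq]] := @adjoin_common_denom (divring_of cK) x q.
  by move=> _ /(nthP 0)[i _ <-]; rewrite coef_map; exact: valP.
have /boolp.choice[u uP] : forall i, exists u : {poly F},
    u \is a polyOver (divring_of cK) /\ u.[x] = q`_i * v.[x].
  move=> i; have [iq|qi] := ltnP i (size q).
    by have [|u uS uE] := vq q`_i; [exact: mem_nth | exists u].
  by exists 0; rewrite rpred0 horner0 nth_default// mul0r.
(* With denominators cleared, [r] is the relation between [x] and [y], read as a polynomial in
   [x]. *)
pose r := \sum_(i < size q) y ^+ i *: u i.
have rx : root r x.
  apply/rootP; rewrite /r horner_sum.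
  under eq_bigr => i _ do rewrite hornerZ (uP i).2.
  transitivity (q.[y] * v.[x]); last by rewrite (rootP py) mul0r.
  by rewrite [q.[y]]horner_coef mulr_suml; apply: eq_bigr => i _; ring.
have Ka : K `<=` acl (K `|` [set y]) by move=> z Kz; apply: sub_acl; left.
set T := acl_closed (K `|` [set y]).
have yT : y \in divring_of T by apply/divring_ofE; apply: sub_acl; right.
have rS : coefs_in (acl (K `|` [set y])) r.
  apply/(polyOver_divring_of T); apply: rpred_sum => i _.
  apply: polyOverZ; first exact: rpredX.
  apply/(polyOver_divring_of T) => j; apply: Ka.
  exact: ((polyOver_divring_of cK _).1 (uP i).1).
have [r0|r0] := eqVneq r 0; last first.
  by have [_ _ _] := T; apply; [exact: rS|exact: r0|].
exfalso; have uq0 (i : 'I_(size q)) : u i = 0.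
  apply/polyP => j; rewrite coef0.
  (* If [r] vanishes, its coefficient at X^j is a relation [w] for [y] over [K], hence trivial. *)
  pose w := \poly_(i < size q) (u i)`_j.
  have w0 : w = 0.
    apply/eqP; apply: contra_notT nKy => w0; case: (cK) => K1 KB _; apply; [|exact: w0|].
      move=> k; rewrite coef_poly; case: ifP => _.
        exact: ((polyOver_divring_of cK _).1 (uP k).1).
      by rewrite -(subrr 1); apply: KB.
    apply/rootP; rewrite horner_poly -[RHS](coef0 _ j) -r0 coef_sum.
    by apply: eq_bigr => k _; rewrite coefZ mulrC.
  by have := congr1 (fun w : {poly F} => w`_i) w0; rewrite coef_poly ltn_ord coef0.
have /negP[] := q0; rewrite -lead_coef_eq0 lead_coefE.
have sq : ((size q).-1 < size q)%N by rewrite ltn_predL size_poly_gt0.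
have := (uP (size q).-1).2; rewrite (uq0 (Ordinal sq)) horner0 => /esym/eqP.
by rewrite mulf_eq0 (negbTE v0) orbF.
Qed.

(** * Transcendence bases *)

Definition alg_indep A := forall t, A t -> ~ acl (A `\ t) t.

(** Zorn's lemma applies because a dependence involves finitely many elements, all in one member of
    a chain; by exchange, a maximal independent set spans. *)
Lemma transcendence_basis : exists2 T, alg_indep T & acl T = setT.
Proof.
have [|T [iT maxT]] := @Zorn_bigcup F alg_indep.
  move=> C Ci Ct t [A CA At] /acl_finitary[s sC st].
  have [B [CB Bt sB]] : exists B, [/\ C B, B t & [set` s] `<=` B].
    elim: s sC {st} => [_|x s IHs sC]; first by exists A.
    have [|B [CB Bt sB]] := IHs.
      by move=> y ys; apply: sC; rewrite /= inE ys orbT.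
    have [[D CD Dx] _] := sC x (mem_head _ _).
    have [BD|DB] := Ct _ _ CB CD; [exists D|exists B]; split => //.
    - exact: BD.
    - by move=> y; rewrite /= inE => /predU1P[->//|/sB/BD].
    - by move=> y; rewrite /= inE => /predU1P[->|/sB//]; apply: DB.
  apply: Ci CB _ Bt _; apply: aclS st => y ys; split; first exact: sB.
  by have [] := sC y ys.
exists T => //; apply/seteqP; split => // x _; apply: contrapT => nTx.
apply: (maxT (T `|` [set x])) => [|t].
  split; first by move=> y Ty; left.
  by move=> /(_ x (or_intror erefl)) /sub_acl.
have xT : ~ T x by move=> /sub_acl.
case=> [Tt|-> ta]; last first.
  by apply: nTx; apply: aclS ta => y [[|]].
move=> ta; apply: nTx.
(* Exchange over the closure of [T] without [t]: as [t] depends on [x], also [x] depends on [t],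
   hence on [T]. *)
have := @acl_exchange (acl (T `\ t)) x t (acl_closed _).
have /[swap] /[apply] : acl (acl (T `\ t) `|` [set x]) t.
  apply: aclS ta => y [[Ty|->] yt]; last by right.
  by left; apply: sub_acl.
move=> /(_ (iT _ Tt)); apply: acl_min; first exact: acl_closed.
move=> y [|->]; last exact: sub_acl.
by apply: aclS => z [].
Qed.

Lemma alg_closed_exhaustion : ~ countable [set: F] ->
  exists K : nat -> set F, [/\ forall n, alg_closed_in (K n),
    forall n, exists t, ~ K n t & \bigcup_n K n = setT].
Proof.
move=> ncF; have [T iT aT] := transcendence_basis.
have [t tT tI] : exists2 t : nat -> F, forall n, T (t n) & injective t.
  have /infiniteP/card_leP[f] : infinite_set T.
    by move=> /finite_set_countable/countable_acl; rewrite aT.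
  exists (fun n => val (f (to_setT n))) => [n|m n /val_inj fmn].
    exact: set_valP.
  exact: (congr1 val ('inj_f (in_setT _) (in_setT _) fmn)).
pose Tn n := T `\` [set t i | i in [set i | (n <= i)%N]].
exists (fun n => acl (Tn n)); split => [n|n|].
- exact: acl_closed.
- exists (t n); move=> tn; apply: (iT _ (tT n)); apply: aclS tn => x [Tx ntx].
  by split => // xE; apply: ntx; exists n => //=.
- apply/seteqP; split => // x _; have : acl T x by rewrite aT.
  move=> /acl_finitary[s sT sx].
  suff [n sn] : exists n, [set` s] `<=` Tn n by exists n => //; apply: aclS sx.
  elim: s sT {sx} => [_|y s IHs sT]; first by exists 0%N.
  have [|n sn] := IHs; first by move=> z zs; apply: sT; rewrite /= inE zs orbT.
  (* [Tn m] lacks [t i] just for m <= i, so [t i] enters at m = i + 1. *)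
  have [m ym] : exists m, Tn m y.
    have [[i _ tiy]|nty] := pselect (exists2 i, True & t i = y).
      exists i.+1; split; first by apply: sT; rewrite /= mem_head.
      by move=> [j /= ij tjy]; move: ij; rewrite -(tI _ _ (etrans tiy (esym tjy))) ltnn.
    exists 0%N; split; first by apply: sT; rewrite /= mem_head.
    by move=> [j _ tjy]; apply: nty; exists j.
  have TnS k l z : (k <= l)%N -> Tn k z -> Tn l z.
    move=> kl [Tz ntz]; split => // -[i /= li tiz]; apply: ntz.
    by exists i => //=; apply: leq_trans li.
  exists (maxn n m) => z /=; rewrite inE => /predU1P[->|/sn].
    by apply: TnS ym; rewrite leq_maxr.
  by apply: TnS; rewrite leq_maxl.
Qed.

End RelativeAlgebraicClosure.

(** * Moebius maps lifted to the line *)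

Section ProjectiveLineCover.
Variable R : realType.
Implicit Types (c x : R).

(** Squared length of the image of the unit vector at angle [x] under the shear. *)
Definition shear_norm c x : R := (cos x + c * sin x) ^+ 2 + sin x ^+ 2.

Lemma shear_norm_ge c x : (3 + 2 * c ^+ 2)^-1 <= shear_norm c x.
Proof.
have c0 : 0 < 3 + 2 * c ^+ 2 by have := sqr_ge0 c; lra.
rewrite -[leLHS]mul1r ler_pdivrMr// -[X in X <= _](cos2Dsin2 x) /shear_norm.
set u := cos x; set v := sin x.
rewrite -subr_ge0.
(* A certificate of positivity as a sum of squares. *)
have -> : ((u + c * v) ^+ 2 + v ^+ 2) * (3 + 2 * c ^+ 2) - (u ^+ 2 + v ^+ 2) =
  (u + 2 * c * v) ^+ 2 + (u + c * v) ^+ 2 + 2 * (c * (u + c * v)) ^+ 2 + 2 * v ^+ 2.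
  by ring.
have := sqr_ge0 (u + 2 * c * v); have := sqr_ge0 (u + c * v).
have := sqr_ge0 (c * (u + c * v)); have := sqr_ge0 v.
lra.
Qed.

Lemma shear_norm_gt0 c x : 0 < shear_norm c x.
Proof.
apply: lt_le_trans (shear_norm_ge c x); rewrite invr_gt0.
by have := sqr_ge0 c; lra.
Qed.

(** * An algebra of bounded functions closed under derivation *)

Lemma is_derive_inv (f : R -> R) x df : is_derive x 1 f df -> f x != 0 ->
  is_derive x 1 (fun y => (f y)^-1) (- df / f x ^+ 2).
Proof.
move=> [Df Dv] fx0; apply: DeriveDef; first exact: derivableV.
by rewrite deriveV// Dv /GRing.scale /=; field.
Qed.

(** A function whose derivative lies in this algebra has bounded derivatives of every order, though
    it may itself be unbounded. *)
Inductive trigrat c : (R -> R) -> Prop :=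
| trigrat_cst a : trigrat c (fun=> a)
| trigrat_sin : trigrat c sin
| trigrat_cos : trigrat c cos
| trigrat_add f g : trigrat c f -> trigrat c g -> trigrat c (fun x => f x + g x)
| trigrat_mul f g : trigrat c f -> trigrat c g -> trigrat c (fun x => f x * g x)
| trigrat_inv : trigrat c (fun x => (shear_norm c x)^-1).

Lemma trigrat_bounded c f : trigrat c f -> exists M : R, forall x, `|f x| <= M.
Proof.
elim=> [a|||{}f g _ [M fM] _ [N gN]|{}f g _ [M fM] _ [N gN]|].
- by exists `|a|.
- by exists 1 => x; rewrite ler_norml sin_geN1 sin_le1.
- by exists 1 => x; rewrite ler_norml cos_geN1 cos_le1.
- by exists (M + N) => x; rewrite (le_trans (ler_normD _ _))// lerD.
- by exists (M * N) => x; rewrite normrM ler_pM.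
- exists (3 + 2 * c ^+ 2) => x.
  rewrite ger0_norm ?invr_ge0 ?(ltW (shear_norm_gt0 _ _))//.
  rewrite -[leRHS]invrK lef_pV2 ?shear_norm_ge// posrE ?shear_norm_gt0//.
  by rewrite invr_gt0; have := sqr_ge0 c; lra.
Qed.

Lemma trigrat_is_derive c f : trigrat c f ->
  exists2 g, trigrat c g & forall x, is_derive x 1 f (g x).
Proof.
elim=> [a|||{}f g _ [f' tf' ff'] _ [g' tg' gg']|{}f g tf [f' tf' ff'] tg [g' tg' gg']|].
- by exists (fun=> 0); [exact: trigrat_cst|move=> x; exact: is_derive_cst].
- by exists cos; [exact: trigrat_cos|move=> x; exact: is_derive_sin].
- exists (fun x => -1 * sin x).
    by apply: trigrat_mul; [exact: trigrat_cst|exact: trigrat_sin].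
  by move=> x; rewrite mulN1r; exact: is_derive_cos.
- exists (fun x => f' x + g' x); first exact: trigrat_add.
  by move=> x; apply: is_deriveD.
- exists (fun x => f x * g' x + g x * f' x).
    by apply: trigrat_add; apply: trigrat_mul.
  by move=> x; apply: is_deriveM.
- pose D' x := 2 * (cos x + c * sin x) * (- sin x + c * cos x) + 2 * sin x * cos x.
  exists (fun x => - 1 * D' x * (shear_norm c x)^-1 * (shear_norm c x)^-1).
    have tS := trigrat_sin c; have tC := trigrat_cos c.
    have tK a := trigrat_cst c a; have tI := trigrat_inv c.
    have -> : D' = fun x => 2 * (cos x + c * sin x) * (-1 * sin x + c * cos x)
        + 2 * sin x * cos x by apply/funext => x; rewrite /D' mulN1r.
    by do ![apply: trigrat_mul => // | apply: trigrat_add => //].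
  move=> x.
  have dD : is_derive x 1 (shear_norm c) (D' x).
    have -> : shear_norm c = (cos + c \*: sin) ^+ 2 + sin ^+ 2.
      by apply/funext => y; rewrite /shear_norm.
    apply: is_derive_eq; rewrite /D' /GRing.scale /=.
    rewrite !fctE /GRing.scale/= -[c *: sin x]/(c * sin x) !expr1; ring.
  have D0 := lt0r_neq0 (shear_norm_gt0 c x).
  by apply: is_derive_eq (is_derive_inv dD D0) _; field.
Qed.

Lemma bounded_derivs_trigrat c (f g : R -> R) : trigrat c g ->
  (forall x, is_derive x 1 f (g x)) -> smooth R f /\ bounded_derivs R f.
Proof.
move=> tg fg.
have step (h h' : R -> R) : (forall x, is_derive x 1 h (h' x)) -> derive1 h = h'.
  move=> hh'; apply/funext => x; rewrite derive1E.
  by have [] := hh' x.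
have fS n : trigrat c (derive1n n.+1 f).
  elim: n => [|n IHn]; first by rewrite derive1n1 (step _ _ fg).
  by have [h th nh] := trigrat_is_derive IHn; rewrite derive1nS (step _ _ nh).
split=> [[|n] x|[//|n] _].
- by have [] := fg x.
- have [h _ nh] := trigrat_is_derive (fS n).
  by have [] := nh x.
- exact: trigrat_bounded (fS n).
Qed.

Lemma DinfLip_trigrat c c' (f g f' g' : R -> R) : trigrat c f' -> trigrat c' g' ->
  (forall x, is_derive x 1 f (f' x)) -> (forall x, is_derive x 1 g (g' x)) ->
  (forall x, 0 < f' x) -> cancel f g -> cancel g f -> DinfLip f.
Proof.
move=> tf tg df dg f0 fK gK.
have [sf bf] := bounded_derivs_trigrat tf df.
have [sg bg] := bounded_derivs_trigrat tg dg.
split; last by exists g.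
move=> x y xy; apply: (@gtr0_derive1_incr _ f x y) => //.
- by move=> z _; rewrite derive1E; have [_ ->] := df z.
- apply: continuous_subspaceT => z; apply: differentiable_continuous.
  by apply/derivable1_diffP; have [] := df z.
Qed.

(** * Lifts of z |-> -1/z ([quarter]) and of the translations ([shear]) *)

Definition quarter x : R := x + pi / 2.

Lemma DinfLip_quarter : DinfLip quarter.
Proof.
have d a x : is_derive x 1 (fun y : R => y + a) 1.
  by apply: is_derive_eq; rewrite addr0.
apply: (@DinfLip_trigrat 0 0 quarter (fun x => x - pi / 2) (fun=> 1) (fun=> 1)
  (trigrat_cst _ _) (trigrat_cst _ _) (d _) (d _)).
- by move=> x; exact: ltr01.
- by move=> x; rewrite /quarter addrK.
- by move=> x; rewrite /quarter subrK.
Qed.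

Definition shear_tan c x : R := c * sin x ^+ 2 / (1 + c * sin x * cos x).

(* The lift fixing 0 of the translation [z |-> z + c] in the coordinate
   [z = cot x]: the vector [(cos x, sin x)] is sheared to
   [(cos x + c sin x, sin x)], turning by an angle of tangent
   [- shear_tan c x]. For [|c| < 2] this angle stays within (-pi/2, pi/2). *)
Definition shear c x : R := x - atan (shear_tan c x).

(** The denominator is 1 + (c/2) sin 2x. *)
Lemma shear_den_gt0 c x : `|c| < 2 -> 0 < 1 + c * sin x * cos x.
Proof.
rewrite ltr_norml => /andP[c1 c2].
have := cos2Dsin2 x; set u := cos x; set v := sin x => uv.
have m1 : 0 <= 1 + 2 * (u * v) by have := sqr_ge0 (u + v); lra.
have m2 : 0 <= 1 - 2 * (u * v) by have := sqr_ge0 (u - v); lra.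
have [c0|/ltW c0] := leP 0 c.
  by have := mulr_ge0 c0 m1; lra.
by move: c0; rewrite -oppr_ge0 => c0; have := mulr_ge0 c0 m2; lra.
Qed.

(** A linear map of determinant 1 moves the angle of a unit vector at a rate of 1 over the squared
    length of its image. *)
Lemma is_derive_shear c x : `|c| < 2 ->
  is_derive x 1 (shear c) (shear_norm c x)^-1.
Proof.
move=> c2; have d0 := shear_den_gt0 x c2.
set u := cos x; set v := sin x.
have uv : u ^+ 2 + v ^+ 2 = 1 by exact: cos2Dsin2.
have den : is_derive x 1 (fun y => 1 + c * sin y * cos y) (c * (u ^+ 2 - v ^+ 2)).
  have -> : (fun y => 1 + c * sin y * cos y) = cst 1 + cst c * sin * cos.
    by apply/funext => y; rewrite !fctE.
  by apply: is_derive_eq; rewrite !fctE /GRing.scale/= -/u -/v; ring.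
have num : is_derive x 1 (fun y => c * sin y ^+ 2) (2 * c * v * u).
  have -> : (fun y => c * sin y ^+ 2) = cst c * sin ^+ 2.
    by apply/funext => y; rewrite !fctE.
  by apply: is_derive_eq; rewrite !fctE /GRing.scale/= -/u -/v; ring.
have := is_deriveM num (is_derive_inv den (lt0r_neq0 d0)).
rewrite -/u -/v => dtan.
have := is_deriveB (is_derive_id x 1) (is_derive1_comp (is_derive1_atan _) dtan).
move=> dshear; apply: (is_derive_eq dshear) => /=.
rewrite !fctE /GRing.scale/= /shear_norm -/u -/v.
have D0 : (u + c * v) ^+ 2 + v ^+ 2 != 0 by exact: lt0r_neq0 (shear_norm_gt0 c x).
move: d0; rewrite -/u -/v => /lt0r_neq0; set e := 1 + c * v * u => e0.
have DE : (u + c * v) ^+ 2 + v ^+ 2 = 1 + 2 * c * v * u + c ^+ 2 * v ^+ 2.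
  by rewrite -[X in _ = X + _ + _]uv; ring.
(* Pythagoras: [e] is the component of the sheared vector along the original one, and c v^2 is the
   transverse one up to sign. *)
have eE : 1 + (c * v ^+ 2 / e) ^+ 2 = ((u + c * v) ^+ 2 + v ^+ 2) / e ^+ 2.
  apply: (mulIf (expf_neq0 2 e0)); rewrite mulfVK ?expf_neq0// mulrDl exprMn.
  rewrite exprVn mulfVK ?expf_neq0// DE /e.
  transitivity (1 + 2 * c * v * u + c ^+ 2 * v ^+ 2 * (u ^+ 2 + v ^+ 2)); first by ring.
  by rewrite uv mulr1.
rewrite eE; apply: (mulIf D0); rewrite mulVf//.
transitivity ((u + c * v) ^+ 2 + v ^+ 2
  + c ^+ 2 * v ^+ 2 * (u ^+ 2 - v ^+ 2) - 2 * c * v * u * e).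
  by field; rewrite e0.
rewrite DE /e.
transitivity (1 + c ^+ 2 * v ^+ 2 * (1 - (u ^+ 2 + v ^+ 2))); first by ring.
by rewrite uv subrr mulr0 addr0.
Qed.

Lemma shear_polar c x : `|c| < 2 -> exists2 l : R, 0 < l &
  cos (shear c x) = l * (cos x + c * sin x) /\ sin (shear c x) = l * sin x.
Proof.
move=> c2; have d0 := shear_den_gt0 x c2.
set a := atan (shear_tan c x).
have ca : 0 < cos a by rewrite cos_gt0_pihalf// atan_gtNpi2 atan_ltpi2.
have sa : sin a = shear_tan c x * cos a.
  by rewrite -[shear_tan c x]atanK -/a /tan mulfVK// lt0r_neq0.
exists (cos a / (1 + c * sin x * cos x)); first by rewrite divr_gt0.
rewrite /shear -/a cosD sinD cosN sinN sa /shear_tan.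
have uv := cos2Dsin2 x; move: d0 => /lt0r_neq0 d0.
split; first last.
  by field.
have -> : cos x + c * sin x = cos x * (1 + c * sin x * cos x) + c * sin x * sin x ^+ 2.
  by rewrite -[in LHS](mulr1 (c * sin x)) -[X in _ + _ * X = _]uv; ring.
by field.
Qed.

Lemma shear_normE c x : shear_norm c x = 1 + 2 * c * sin x * cos x + c ^+ 2 * sin x ^+ 2.
Proof. by rewrite -[X in _ = X + _ + _](cos2Dsin2 x) /shear_norm; ring. Qed.

(** The opposite shear turns back by the same angle; by [lD], the factor [l] is the reciprocal
    length of the sheared vector. *)
Lemma shearK c : `|c| < 2 -> cancel (shear c) (shear (- c)).
Proof.
move=> c2 x; have [l l0 [cl sl]] := shear_polar x c2.
have d0 := shear_den_gt0 x c2.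
suff t : shear_tan (- c) (shear c x) = - shear_tan c x.
  by rewrite {1}/shear t atanN opprK /shear subrK.
have lD : l ^+ 2 * shear_norm c x = 1.
  by rewrite -(cos2Dsin2 (shear c x)) cl sl /shear_norm; ring.
rewrite /shear_tan sl cl.
have -> : 1 + - c * (l * sin x) * (l * (cos x + c * sin x)) =
    l ^+ 2 * (1 + c * sin x * cos x).
  by rewrite -[X in X + _ = _]lD shear_normE; ring.
field; rewrite !lt0r_neq0//.
Qed.

Lemma DinfLip_shear c : `|c| < 2 -> DinfLip (shear c).
Proof.
move=> c2; have c2' : `|- c| < 2 by rewrite normrN.
apply: (@DinfLip_trigrat c (- c) _ (shear (- c)) (fun x => (shear_norm c x)^-1)
  (fun x => (shear_norm (- c) x)^-1)).
- exact: trigrat_inv.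
- exact: trigrat_inv.
- by move=> x; exact: is_derive_shear.
- by move=> x; exact: is_derive_shear.
- by move=> x; rewrite invr_gt0 shear_norm_gt0.
- exact: shearK.
- by move=> x; have := shearK c2' x; rewrite opprK.
Qed.

End ProjectiveLineCover.

(** * The tree of reduced words *)

Section FreeAction.
Variables (R : realType) (K : set R) (cK : alg_closed_in K) (t : R).
Hypotheses (Kt : ~ K t) (t1 : `|t| < 1).
Implicit Types (a b c x : R) (p q : {poly R}).

Let S := divring_of cK.

Lemma horner_transcendental_neq0 p : p \is a polyOver S -> p != 0 -> p.[t] != 0.
Proof.
move=> /polyOver_divring_of pK p0; apply/eqP => /rootP pt; apply: Kt.
by case: cK => _ _ _; apply; [exact: pK|exact: p0|exact: pt].
Qed.

(** Positivity keeps the leading terms nonzero in the degree counts; a < 1 and |t| < 1 keep both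
    shear parameters, a and a t, below 2 in absolute value. *)
Definition params : set R := [set a | K a /\ 0 < a < 1].

Lemma params_norm a : params a -> `|a| < 2.
Proof. by move=> [_ /andP[a0 a1]]; rewrite gtr0_norm//; lra. Qed.

Lemma params_norm_mul a : params a -> `|a * t| < 2.
Proof.
move=> [_ /andP[a0 a1]]; rewrite normrM gtr0_norm//.
have : a * `|t| <= 1 by rewrite mulr_ile1// ltW.
by move=> /le_lt_trans; apply; rewrite ltr1n.
Qed.

(* The lift of the Moebius map [z |-> a - 1 / (z + a t)]. *)
Definition frac_step a x := shear a (quarter (shear (a * t) x)).

Definition frac_unstep a x := shear (- (a * t)) (shear (- a) x - pi / 2).

Lemma frac_stepK a : params a -> cancel (frac_step a) (frac_unstep a).
Proof.
move=> Ya x; rewrite /frac_unstep /frac_step shearK ?params_norm//.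
by rewrite /quarter addrK shearK// params_norm_mul.
Qed.

Lemma frac_unstepK a : params a -> cancel (frac_unstep a) (frac_step a).
Proof.
move=> Ya x; rewrite /frac_unstep /frac_step -{1}[a * t]opprK.
rewrite shearK ?normrN ?params_norm_mul//.
by rewrite /quarter subrK -{1}[a]opprK shearK// normrN params_norm.
Qed.

(** The equation cot x = p(t) / q(t) in homogeneous form, which allows the point at infinity. *)
Definition direction x p q := p.[t] * sin x = q.[t] * cos x.

Lemma direction_shear c d p q x : `|c| < 2 -> d.[t] = c ->
  direction x p q -> direction (shear c x) (p + d * q) q.
Proof.
move=> c2 dc; rewrite /direction !hornerE dc => pq.
have [l _ [-> ->]] := shear_polar x c2.
transitivity (l * (p.[t] * sin x) + l * (c * q.[t] * sin x)); first by ring.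
by rewrite pq; ring.
Qed.

Lemma direction_step a p q x : params a -> direction x p q ->
  direction (frac_step a x)
    (- q + a%:P * (p + a *: 'X * q)) (p + a *: 'X * q).
Proof.
move=> Ya pq; apply: direction_shear; [exact: params_norm|exact: hornerC|].
have := @direction_shear (a * t) (a *: 'X) _ _ _ (params_norm_mul Ya) _ pq.
rewrite !hornerE => /(_ erefl); set u := p + _.
rewrite /direction /quarter sinDpihalf cosDpihalf hornerN mulrN mulNr.
by move=> ->.
Qed.

Lemma direction_unstep a p q x : params a -> direction x p q ->
  direction (frac_unstep a x)
    (q + - (a *: 'X) * - (p - a%:P * q)) (- (p - a%:P * q)).
Proof.
move=> Ya pq; apply: direction_shear.
- by rewrite normrN params_norm_mul.
- by rewrite !hornerE.
have := @direction_shear (- a) (- a%:P) _ _ _ _ _ pq.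
rewrite normrN (params_norm Ya) !hornerE mulNr => /(_ erefl erefl).
set u := p - _; set y := shear _ _.
rewrite /direction cosB sinB cos_pihalf sin_pihalf !mulr0 !mulr1 !hornerN.
rewrite !add0r mulrN mulNr => <-.
by [].
Qed.

(* Images of 0 under reduced words with first letter [frac_step a]; the last
   letter is [frac_step c] or its inverse, according to the boolean. *)
Inductive word a : bool -> R -> R -> Prop :=
| word_start : word a true a (frac_step a 0)
| word_step s b x c : word a s b x -> params c -> ~ (s = false /\ b = c) ->
    word a true c (frac_step c x)
| word_unstep s b x c : word a s b x -> params c -> ~ (s = true /\ b = c) ->
    word a false c (frac_unstep c x).

(* In the coordinate [z = p / q], graded by the degree in the transcendental
   [t], [z - c] is infinitesimal after a letter [frac_step c], and [z + c t] is
   finite after its inverse. *)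
Definition reduced_fraction (s : bool) c p q :=
  if s return Prop then (size (p - c%:P * q)%R < size q)%N
  else q != 0 /\ (size (p + c *: 'X * q)%R <= size q)%N.

Lemma size_mulCX c q : c != 0 -> q != 0 -> size (c *: 'X * q) = (size q).+1.
Proof.
by move=> c0 q0; rewrite -scalerAl size_scale// mulrC size_mulX.
Qed.

(** For z = p / q one has q' = (z + c X) q. After a step z is finite and c X dominates; after an
    inverse step z + b X is finite and (c - b) X dominates. So q' has larger degree than q, and the
    new z - c is - q / q'. *)
Lemma reduced_fraction_step s b c p q : params c ->
  ~ (s = false /\ b = c) -> reduced_fraction s b p q ->
  let q' := p + c *: 'X * q in reduced_fraction true c (- q + c%:P * q') q'.
Proof.
move=> [_ /andP[c0 _]] sb pq q'; rewrite /reduced_fraction addrK size_polyN.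
suff -> : size q' = (size q).+1 by [].
case: s sb pq => /= sb; last first.
  move=> [q0 pq]; have bc : c - b != 0.
    by rewrite subr_eq0; apply/eqP => cb; apply: sb.
  have -> : q' = (c - b) *: 'X * q + (p + b *: 'X * q).
    by rewrite /q' scalerBl; ring.
  by rewrite size_polyDl size_mulCX// ltnS.
move=> pq; have q0 : q != 0 by apply: contraTneq pq => ->; rewrite size_poly0.
have -> : q' = c *: 'X * q + (p - b%:P * q + b%:P * q) by rewrite /q'; ring.
rewrite size_polyDl size_mulCX ?lt0r_neq0// ltnS.
rewrite (leq_trans (size_polyD _ _))// geq_max (ltnW pq).
by rewrite mul_polyC size_scale_leq.
Qed.

(** Here the new z + c X is q / q' with q' = (c - z) q. After a step c - z is close to the nonzero
    constant c - b; after an inverse step z grows like - b X. Either way q' has at least the degree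
    of q. *)
Lemma reduced_fraction_unstep s b c p q : params b -> params c ->
  ~ (s = true /\ b = c) -> reduced_fraction s b p q ->
  let q' := - (p - c%:P * q) in reduced_fraction false c (q + - (c *: 'X) * q') q'.
Proof.
move=> [_ /andP[b0 _]] _ sb pq q'; rewrite /reduced_fraction.
have -> : q + - (c *: 'X) * q' + c *: 'X * q' = q by ring.
suff : (size q <= size q')%N /\ q != 0.
  move=> [qq' q0]; split => //.
  by rewrite -size_poly_gt0 (leq_trans _ qq')// size_poly_gt0.
rewrite /q' size_polyN; case: s sb pq => /= sb.
  move=> pq; have q0 : q != 0 by apply: contraTneq pq => ->; rewrite size_poly0.
  have bc : b - c != 0.
    by rewrite subr_eq0; apply/eqP => cb; apply: sb.
  have -> : p - c%:P * q = (b - c) *: q + (p - b%:P * q).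
    by rewrite -mul_polyC polyCB; ring.
  by rewrite size_polyDl size_scale.
move=> [q0 pq]; split => //.
have -> : p - c%:P * q = - (b *: 'X * q) + (p + b *: 'X * q - c%:P * q) by ring.
rewrite size_polyDl size_polyN size_mulCX ?lt0r_neq0// ltnS.
rewrite (leq_trans (size_polyD _ _))// geq_max pq size_polyN.
by rewrite mul_polyC size_scale_leq.
Qed.

Lemma word_reduced a s c x : params a -> word a s c x ->
  params c /\ exists p q, [/\ p \is a polyOver S, q \is a polyOver S,
    direction x p q & reduced_fraction s c p q].
Proof.
have KS b : params b -> b \in S by move=> [Kb _]; apply/divring_ofE.
move=> Ya; elim=> [|{}s b {}x {}c _ [Yb [p [q [pS qS pq rpq]]]] Yc sb
  |{}s b {}x {}c _ [Yb [p [q [pS qS pq rpq]]]] Yc sb]; split => //.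
(* The starting point is z = 1 / 0, and the first letter sends it to a / 1. *)
- have d0 : direction 0 1 0 by rewrite /direction sin0 horner0 mulr0 mul0r.
  have := direction_step Ya d0.
  set q' := 1 + _; set p' := _ + _ => pq'.
  exists p', q'; rewrite /p' /q' mulr0 addr0 mulr1 oppr0 add0r; split.
  + by rewrite polyOverC KS.
  + exact: rpred1.
  + by move: pq'; rewrite /p' /q' mulr0 addr0 mulr1 oppr0 add0r.
  + by rewrite /reduced_fraction mulr1 subrr size_poly0 size_poly1.
- have := direction_step Yc pq; have /= := reduced_fraction_step Yc sb rpq.
  set q' := p + _; set p' := - _ + _ => rpq' pq'.
  have q'S : q' \is a polyOver S.
    by rewrite /q' rpredD// rpredM// polyOverZ ?KS// polyOverX.
  have p'S : p' \is a polyOver S.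
    by rewrite /p' rpredD ?rpredN// rpredM// polyOverC KS.
  by exists p', q'.
- have := direction_unstep Yc pq; have /= := reduced_fraction_unstep Yb Yc sb rpq.
  set q' := - (p - _); set p' := q + _ => rpq' pq'.
  have q'S : q' \is a polyOver S by rewrite /q' rpredN rpredB// rpredM// polyOverC KS.
  have p'S : p' \is a polyOver S.
    by rewrite /p' rpredD// rpredM// rpredN polyOverZ ?KS// polyOverX.
  by exists p', q'.
Qed.

(** The point 0 would force q(t) = 0, against the transcendence of t. *)
Lemma word_neq0 a s c x : params a -> word a s c x -> x <> 0.
Proof.
move=> Ya /(word_reduced Ya)[_ [p [q [_ qS pq rpq]]]] x0.
have q0 : q != 0.
  case: s rpq => /= [pq'|[]//]; apply: contraTneq pq' => ->.
  by rewrite size_poly0.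
have /eqP[] := horner_transcendental_neq0 qS q0.
by move: pq; rewrite x0 /direction sin0 cos0 mulr0 mulr1.
Qed.

(* The hole at 0 removes exactly the edges from 0 to the points
   [frac_step a 0]; the classes are the components of what remains of the
   Schreier graph. *)
Definition punctured_orbit x y := forall I : set R,
  (forall a z, params a -> z <> 0 -> I z <-> I (frac_step a z)) -> I x <-> I y.

Lemma punctured_orbit_equiv : is_equiv_rel punctured_orbit.
Proof.
split; first by move=> x I _.
split; first by move=> x y xy I HI; have := xy I HI; tauto.
by move=> x y z xy yz I HI; have := xy I HI; have := yz I HI; tauto.
Qed.

Lemma punctured_orbit_step a x : params a -> x <> 0 ->
  punctured_orbit x (frac_step a x).
Proof. by move=> Ya x0 I; apply. Qed.

(** The images of 0 under reduced words starting with [frac_step a] form a set invariant along all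
    remaining edges. If it contains [frac_step b 0], undoing [b] leads back to 0, which no reduced
    word reaches, unless the word is a single letter and a = b. *)
Lemma punctured_orbit_base a b : params a -> params b ->
  punctured_orbit (frac_step a 0) (frac_step b 0) -> a = b.
Proof.
move=> Ya Yb /(_ [set x | exists s c, word a s c x])[].
  move=> c x Yc x0; split=> -[s [d w]].
    have [[sF dc]|sd] := pselect (s = false /\ d = c); last first.
      by exists true, c; apply: word_step w Yc sd.
    move: sF dc w x0 => -> -> w x0.
    have : exists s b y, word a s b y /\ x = frac_unstep c y.
      by inversion w; subst; do 3 eexists; split; [eassumption|].
    by move=> [r [b' [y [wy ->]]]]; rewrite frac_unstepK//; exists r, b'.
  have [[sT dc]|sd] := pselect (s = true /\ d = c); last first.
    by exists false, c; rewrite -[x](frac_stepK Yc); apply: word_unstep w Yc sd.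
  move: sT dc w => -> -> w.
  (* Removing the last letter leaves a reduced word or nothing; in the latter case x = 0, which is
     excluded. *)
  have : (frac_step c x = frac_step c 0) \/
     exists s b y, word a s b y /\ frac_step c x = frac_step c y.
    inversion w; subst; first by left.
    by right; do 3 eexists; split; [eassumption|].
  case=> [/(can_inj (frac_stepK Yc))//|[r [b' [y [wy]]]]].
  by move=> /(can_inj (frac_stepK Yc)) ->; exists r, b'.
move=> + _; case; first by exists true, a; exact: word_start.
move=> s [c w]; have [[sT cb]|sc] := pselect (s = true /\ c = b); last first.
  by have /(word_neq0 Ya)[] := word_unstep w Yb sc; rewrite frac_stepK.
move: sT cb w => -> -> w.
have : a = b \/ exists s b' y, word a s b' y /\ frac_step b 0 = frac_step b y.
  inversion w; subst; first by left.
  by right; do 3 eexists; split; [eassumption|].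
case=> // -[r [b' [y [wy]]]] /(can_inj (frac_stepK Yb)) y0.
by case: (word_neq0 Ya wy).
Qed.

Lemma frac_step0 a : params a -> frac_step a 0 = pi / 2 - atan a.
Proof.
move=> Ya; have -> : frac_step a 0 = shear a (pi / 2).
  rewrite /frac_step {2}/shear /shear_tan sin0 expr0n mulr0 mul0r atan0.
  by rewrite subr0 /quarter add0r.
by rewrite /shear /shear_tan sin_pihalf cos_pihalf !mulr0 addr0 divr1 expr1n mulr1.
Qed.

End FreeAction.

(** * Predictors *)

Section Predictors.
Variables (R : realType) (K : set R) (cK : alg_closed_in K) (t : R).
Hypotheses (Kt : ~ K t) (t1 : `|t| < 1).

Let E := punctured_orbit K t.

Definition orbit_class (x : R) : quot E := exist _ (E x) (ex_intro _ x erefl).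

Lemma orbit_classP x y : orbit_class x = orbit_class y <-> E x y.
Proof.
have [Er [Es Et]] := punctured_orbit_equiv K t.
split=> [[/(congr1 (fun A => A y))] xy|xy]; first by rewrite -/E xy.
apply: eq_exist; apply/funext => z; apply/propext; split => h.
  exact: Et (Es _ _ xy) h.
exact: Et xy h.
Qed.

(** Anonymity is applied to the three factors of [frac_step] in turn; off 0 a point is equivalent to
    its image, so the colouring is unchanged. *)
Lemma anonymous_weak_predictor_orbit (Q : weak_predictor R (quot E)) a :
  anonymous_weak_predictor DinfLip Q -> params K a ->
  Q (frac_step t a 0) (restr_ne orbit_class (frac_step t a 0)) =
  Q 0 (restr_ne orbit_class 0).
Proof.
move=> aQ Ya.
have a2 := params_norm Ya; have at2 := params_norm_mul t1 Ya.
rewrite /frac_step -(aQ _ (DinfLip_shear a2)) -(aQ _ (DinfLip_quarter R)).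
rewrite -(aQ _ (DinfLip_shear at2)); congr (Q 0 _).
apply/funext => -[x x0]; apply/orbit_classP.
have [_ [Es _]] := punctured_orbit_equiv K t.
by apply: Es; apply: punctured_orbit_step.
Qed.

Lemma no_good_anonymous_weak_predictor (Q : weak_predictor R (quot E)) :
  ~ lnull R [set pi / 2 - atan a | a in params K] ->
  good_weak_predictor Q -> ~ anonymous_weak_predictor DinfLip Q.
Proof.
move=> nnull gQ aQ; apply: nnull.
pose q0 := Q 0 (restr_ne orbit_class 0).
(* [z] is the point of the family whose class is the common guess [q0], if there is one; otherwise
   any point serves. *)
have [z zP] : exists z, [set pi / 2 - atan a | a in params K] `<=`
    [set x | Q x (restr_ne orbit_class x) <> orbit_class x] `|` [set z].
  have [[a [Ya aq]]|na] := pselect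
      (exists a, params K a /\ orbit_class (frac_step t a 0) = q0).
    exists (frac_step t a 0) => _ [b Yb <-]; rewrite -(frac_step0 t Yb).
    have [<-|ab] := pselect (a = b); [by right|left].
    rewrite /= (anonymous_weak_predictor_orbit aQ Yb) -/q0 -aq => /orbit_classP.
    by move=> /(punctured_orbit_base cK Kt t1 Ya Yb).
  exists 0 => _ [b Yb <-]; left; rewrite -(frac_step0 t Yb) /=.
  rewrite (anonymous_weak_predictor_orbit aQ Yb) -/q0 => qb.
  by apply: na; exists b.
rewrite /lnull; apply: negligibleS; [exact: zP|apply: negligibleU]; first exact: gQ.
exists [set z]; split => //; first exact: lebesgue_measure_set1.
Qed.

End Predictors.

(** * Predictors as weak predictors that ignore the values above the hole *)

Section WeakOfPredictor.
Variables (R : realType) (T : Type) (P : predictor R T).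

Definition weak_of_predictor : weak_predictor R T := fun h f =>
  P (fun x : {x : R | x < h} =>
       f (exist _ (sval x) (elimF eqP (lt_eqF (svalP x))))).

Lemma weak_of_predictorE F h :
  weak_of_predictor (restr_ne F h) = P (restr_lt F h).
Proof. by []. Qed.

Lemma good_weak_of_predictor :
  good_predictor P -> good_weak_predictor weak_of_predictor.
Proof. by []. Qed.

Lemma anonymous_weak_of_predictor U :
  anonymous_predictor U P -> anonymous_weak_predictor U weak_of_predictor.
Proof. by move=> aP phi Uphi F h; rewrite !weak_of_predictorE aP. Qed.

End WeakOfPredictor.

(** * A proper subfield that is large enough *)

Section Existence.
Variable R : realType.

Lemma itv_not_lnull (a b : R) : a < b -> ~ lnull R `]a, b[.
Proof.
move=> ab [B [mB B0 sB]].
have : (lebesgue_measure (`]a, b[%classic : set R) <= lebesgue_measure B)%E.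
  by apply: le_measure; rewrite ?inE.
by rewrite B0 lebesgue_measure_itv /= lte_fin ab -EFinB lee_fin subr_le0 leNgt ab.
Qed.

Lemma uncountable_real : ~ countable [set: R].
Proof.
move=> /countable_lebesgue_measure0 R0; apply: (@itv_not_lnull 0 1 ltr01).
by exists setT.
Qed.

Lemma nonnull_subfield : exists K : set R, exists t,
  [/\ alg_closed_in K, ~ K t, `|t| < 1 &
      ~ lnull R [set pi / 2 - atan a | a in params K]].
Proof.
have [K [cK Kproper KT]] := alg_closed_exhaustion uncountable_real.
have [n Kn] : exists n, ~ lnull R [set pi / 2 - atan a | a in params (K n)].
  apply: contrapT => /forallNP allnull.
  (* The values pi/2 - atan a for 0 < a < 1 fill the open interval between these bounds. *)
  have atan1_gt0 : pi / 2 - atan 1 < pi / 2 :> R.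
    by rewrite gtrBl -atan0 lt_atan.
  apply: (itv_not_lnull atan1_gt0).
  have: lnull R (\bigcup_n [set pi / 2 - atan a | a in params (K n)]).
    by apply: negligible_bigcup => n; apply: contrapT; exact: allnull.
  apply: negligibleS => y /=; rewrite in_itv /= => /andP[y1 y2].
  have y3 : pi / 2 - y \in `]-(pi / 2), (pi / 2)[.
    rewrite in_itv /=; have := @atan_ltpi2 R 1; have := @pi_gt0 R.
    move: y1 y2; lra.
  have [n _ Kna] : (\bigcup_n K n) (tan (pi / 2 - y)) by rewrite KT.
  exists n => //; exists (tan (pi / 2 - y)); last by rewrite tanK//; ring.
  split => //; apply/andP; split.
    rewrite ltNge; apply/negP => /(@le_atan R); rewrite atan0 tanK//.
    by move: y2; lra.
  rewrite ltNge; apply/negP => /(@le_atan R); rewrite tanK//.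
  by move: y1; lra.
have [u Ku] := Kproper n; exists (K n).
(* Dividing by a large integer makes the absolute value less than 1 and stays outside the
   subfield. *)
pose m := (Num.bound `|u|).+1.
have m0 : (m%:R : R) != 0 by rewrite pnatr_eq0.
exists (u / m%:R); split => //.
  move=> /(divring_ofE (cK n)) um; apply: Ku; apply/(divring_ofE (cK n)).
  by rewrite -(divfK m0 u) rpredM// rpred_nat.
rewrite normrM normfV normr_nat ltr_pdivrMr ?ltr0n// mul1r.
by rewrite (lt_le_trans (archi_boundP _))// ?ler_nat.
Qed.

End Existence.

Theorem theorem1p8 (R : realType) :
  exists E : R -> R -> Prop,
    is_equiv_rel E /\
    ~ (exists P : predictor R (quot E),
         good_predictor P /\ anonymous_predictor (@DinfLip R) P) /\
    ~ (exists Q : weak_predictor R (quot E),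
         good_weak_predictor Q /\ anonymous_weak_predictor (@DinfLip R) Q).
Proof.
have [K [t [cK Kt t1 nK]]] := nonnull_subfield R.
exists (punctured_orbit K t); split; first exact: punctured_orbit_equiv.
have noQ := @no_good_anonymous_weak_predictor _ _ cK _ Kt t1.
split=> [[P [gP aP]]|[Q [gQ aQ]]]; last exact: noQ nK gQ aQ.
exact: noQ nK (good_weak_of_predictor gP) (anonymous_weak_of_predictor aP).
Qed.
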